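(* Let $m\ge 0$ and $n\ge 0$ be integers and let $g:\mathbb{R}^{m+n}\to\mathbb{R}$ be a Borel function of $m+n$ arguments such that $$\mathbf{E}\, g(\xi_1,\dots,\xi_m,\eta_1,\dots,\eta_n)\ge 0$$ for all independent random variables $\xi_1,\dots,\xi_m,\eta_1,\dots,\eta_n$ where each of the random variables $\xi_j$ has a centered two-point distribution or equals zero, and each of the random variables $\eta_j$ has a symmetric two-point distribution or equals zero. Then, for all independent real random variables $\xi_1,\dots,\xi_m,\eta_1,\dots,\eta_n$, where the random variables $\xi_j$ are centered and the random variables $\eta_j$ are symmetric, the inequality $$\mathbf{E}\, g(\xi_1,\dots,\xi_m,\eta_1,\dots,\eta_n)\ge 0$$ is valid whenever the expectation exists.
   Context: A random variable $\xi$ is centered if $\mathbf{E}|\xi|<\infty$ and $\mathbf{E}\xi=0$; it is symmetric if $\xi$ and $-\xi$ have the same distribution. A centered two-point distribution is the distribution of a random variable taking values $-a$ and $b$, where $a,b>0$, with probabilities $b/(a+b)$ and $a/(a+b)$ respectively. A symmetric two-point distribution is the distribution of a random variable taking values $-a$ and $a$, where $a>0$, with probability $1/2$ each. *)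

(* Defs.v *)
From HB Require Import structures.
From mathcomp Require Import all_boot all_order all_algebra.
From mathcomp Require Import all_classical all_reals all_analysis.

Set Implicit Arguments.
Unset Strict Implicit.
Unset Printing Implicit Defensive.

Import Order.TTheory GRing.Theory Num.Theory.

Local Open Scope classical_set_scope.
Local Open Scope ring_scope.
Local Open Scope ereal_scope.

(* The product rule over the whole index set gives the rule for every
   subfamily, by taking [A i = setT] for the remaining indices. *)
Definition mutually_independent (d : measure_display) (T : measurableType d)
    (R : realType) (P : probability T R) (k : nat)
    (X : 'I_k -> {RV P >-> R}) : Prop :=
  forall A : 'I_k -> set R, (forall i, measurable (A i)) ->
    P (\bigcap_(i in [set: 'I_k]) X i @^-1` A i) =
      \prod_(i < k) P (X i @^-1` A i).

Definition centered (d : measure_display) (T : measurableType d)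
    (R : realType) (P : probability T R) (X : {RV P >-> R}) : Prop :=
  P.-integrable [set: T] (EFin \o X) /\ 'E_P[X] = 0.

Definition symmetric_rv (d : measure_display) (T : measurableType d)
    (R : realType) (P : probability T R) (X : {RV P >-> R}) : Prop :=
  forall A : set R, measurable A ->
    distribution P X A = pushforward P (\- X)%R A.

Definition centered_two_point (d : measure_display) (T : measurableType d)
    (R : realType) (P : probability T R) (X : {RV P >-> R}) : Prop :=
  exists a b : R, [/\ (0 < a)%R, (0 < b)%R &
    forall A : set R, measurable A ->
      distribution P X A =
        (b / (a + b))%:E * \d_(- a)%R A + (a / (a + b))%:E * \d_b A].

Definition symmetric_two_point (d : measure_display) (T : measurableType d)
    (R : realType) (P : probability T R) (X : {RV P >-> R}) : Prop :=
  exists a : R, (0 < a)%R /\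
    forall A : set R, measurable A ->
      distribution P X A =
        (2^-1)%:E * \d_(- a)%R A + (2^-1)%:E * \d_a A.

Definition zero_rv (d : measure_display) (T : measurableType d)
    (R : realType) (P : probability T R) (X : {RV P >-> R}) : Prop :=
  forall w : T, X w = 0%R.

(* The expectation may be infinite.  The condition excludes [+oo - oo], to
   which the library integral assigns the value [-oo]. *)
Definition expectation_exists (d : measure_display) (T : measurableType d)
    (R : realType) (P : probability T R) (Y : T -> R) : Prop :=
  'E_P[Y^\+] < +oo \/ 'E_P[Y^\-] < +oo.

Definition apply_rvs (d : measure_display) (T : measurableType d)
    (R : realType) (P : probability T R) (k : nat)
    (g : k.-tuple R -> R) (X : 'I_k -> {RV P >-> R}) : T -> R :=
  fun w => g [tuple X i w | i < k].

(* Main.v *)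
Require Import Defs.
From HB Require Import structures.
From mathcomp Require Import all_boot all_order all_algebra.
From mathcomp Require Import all_classical all_reals all_analysis.
From mathcomp Require Import measurable_realfun.

Import Order.TTheory GRing.Theory Num.Theory.

Local Open Scope classical_set_scope.
Local Open Scope ring_scope.
Local Open Scope ereal_scope.

(* By Tonelli the arguments can be replaced one at a time by arbitrary centered
   or symmetric ones in the inequality E g^-(X) <= E g^+(X) between integrals
   with values in [0, +oo]; for two-point or zero arguments this inequality is
   the hypothesis on g.  In one variable, let F >= 0 and let E F(tau) be its mean
   under the centered law tau on {x, y}, where x < 0 < y; then
   (y - x) E F(tau) = y F(x) - x F(y).  Integrating this over x < 0 < y against
   mu x mu, where mu is centered, gives c times the integral of F over x != 0,
   where c is the common value of the integrals of x over x > 0 and of - x over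
   x < 0.  For symmetric mu one integrates F(x) + F(- x) instead.  The existence
   of the expectation is needed only to return from E g^- <= E g^+ to E g >= 0. *)

(** * Products of two probability measures *)

Section product_of_probabilities.
Context {d1 d2 : measure_display} {T1 : measurableType d1}
  {T2 : measurableType d2} {R : realType}.
Variables (P : probability T1 R) (Q : probability T2 R).

(** A named copy of the product measure, to which the structure of a probability is attached. *)
Definition prod_prob : set (T1 * T2) -> \bar R := P \x Q.

HB.instance Definition _ := Measure.on prod_prob.

Let prod_prob_setT : prod_prob setT = 1.
Proof.
rewrite /prod_prob -setXTT [LHS]product_measure1E//.
by rewrite -[RHS]mule1; congr (_ * _); exact: probability_setT.
Qed.

HB.instance Definition _ :=
  Measure_isProbability.Build _ _ _ prod_prob prod_prob_setT.

End product_of_probabilities.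

(** * Finite product probabilities on tuples *)

Section tuple_probability.
Context {d : measure_display} {T : measurableType d} {R : realType}.

Definition cons_pair (k : nat) (x : T * k.-tuple T) : k.+1.-tuple T :=
  [tuple of x.1 :: x.2].

Lemma measurable_cons_pair (k : nat) : measurable_fun setT (@cons_pair k).
Proof. exact: measurable_cons. Qed.

HB.instance Definition _ (k : nat) :=
  isMeasurableFun.Build _ _ _ _ (@cons_pair k) (@measurable_cons_pair k).

(** This is the product of [mu 0], ..., [mu (k-1)]. The recursion splits off the head, so that
    Tonelli for two factors serves inductions on [k]. *)
Fixpoint tuple_prob (k : nat) :
    ('I_k -> probability T R) -> probability (k.-tuple T) R :=
  match k with
  | 0 => fun=> \d_[tuple]
  | k'.+1 => fun mu => distribution
      (prod_prob (mu ord0) (tuple_prob k' (mu \o lift ord0))) (@cons_pair k')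
  end.

Definition box (k : nat) (A : 'I_k -> set T) : set (k.-tuple T) :=
  \bigcap_(i in [set: 'I_k]) (fun t => tnth t i) @^-1` A i.

Lemma measurable_box k (A : 'I_k -> set T) :
  (forall i, measurable (A i)) -> measurable (box k A).
Proof.
move=> mA; apply: fin_bigcap_measurable => // i _.
by rewrite -[_ @^-1` _]setTI; exact: measurable_tnth.
Qed.

Lemma tuple_prob_box k (mu : 'I_k -> probability T R) (A : 'I_k -> set T) :
  (forall i, measurable (A i)) ->
  tuple_prob k mu (box k A) = \prod_(i < k) mu i (A i).
Proof.
elim: k mu A => [|k IH] mu A mA /=.
  rewrite big_ord0 /dirac/= indicE mem_set//.
  by case.
rewrite /distribution/= /pushforward.
rewrite (_ : _ @^-1` _ = A ord0 `*` box k (A \o lift ord0)); last first.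
  apply/seteqP; split => -[x t] /=.
    move=> xtA; split; first by have := xtA ord0 I.
    by move=> i _ /=; have := xtA (lift ord0 i) I; rewrite /= tnthS.
  move=> [Ax At] i _ /=; case: (unliftP ord0 i) => [j ->|-> //].
  by rewrite tnthS; exact: At.
rewrite /prod_prob [LHS]product_measure1E//; last first.
  by apply: measurable_box => i; exact: mA.
by rewrite big_ord_recl; congr (_ * _); rewrite -IH// => i; exact: mA.
Qed.

Lemma boxI k (A B : 'I_k -> set T) :
  box k A `&` box k B = box k (fun i => A i `&` B i).
Proof.
apply/seteqP; split => [t [tA tB] i _|t tAB].
  by split; [exact: tA|exact: tB].
by split=> i _; have [] := tAB i I.
Qed.

(** Boxes are stable under intersection, include the whole space and generate the sigma-algebra of
    tuples, so their values determine a probability. *)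
Lemma tuple_prob_unique k (mu : 'I_k -> probability T R)
    (Q : probability (k.-tuple T) R) :
  (forall A : 'I_k -> set T, (forall i, measurable (A i)) ->
    Q (box k A) = \prod_(i < k) mu i (A i)) ->
  forall B, measurable B -> Q B = tuple_prob k mu B.
Proof.
move=> QE B mB.
pose G := [set C | exists2 A : 'I_k -> set T,
  (forall i, measurable (A i)) & C = box k A].
have GT : G setT by exists (fun=> setT) => //; apply/seteqP; split.
apply: (@measure_unique _ R (k.-tuple T) G (fun=> setT)) => //.
- apply/seteqP; split => [C|].
    apply: smallest_sub; first exact: smallest_sigma_algebra.
    move=> D; rewrite -bigcup_seq => -[i /= _ [A mA <-]].
    (* A coordinate preimage is a box whose other sides are the whole space. *)
    apply: sub_sigma_algebra; exists (fun j => if j == i then A else setT).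
      by move=> j; case: ifP.
    rewrite setTI; apply/seteqP; split => t /=.
      by move=> tA j _ /=; case: eqP => // ->.
    by move=> /(_ i I)/=; rewrite eqxx.
  apply: smallest_sub; first exact: sigma_algebra_measurable.
  by move=> _ [A mA ->]; exact: measurable_box.
- move=> C D [A mA ->] [A' mA' ->]; rewrite boxI.
  by exists (fun i => A i `&` A' i) => // i; exact: measurableI.
- by rewrite bigcup_const.
- by move=> C [A mA ->];
  exact: etrans (QE A mA) (esym (tuple_prob_box k mu A mA)).
- by move=> _; rewrite [ltLHS](probability_setT Q) ltry.
Qed.

Lemma ge0_integral_tuple_probS k (mu : 'I_k.+1 -> probability T R)
    (f : k.+1.-tuple T -> \bar R) :
  measurable_fun [set: k.+1.-tuple T] f -> (forall t, 0 <= f t) ->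
  \int[tuple_prob k.+1 mu]_t f t =
  \int[mu ord0]_x \int[tuple_prob k (mu \o lift ord0)]_t f [tuple of x :: t].
Proof.
move=> mf f0 /=.
rewrite ge0_integral_distribution//.
rewrite fubini_tonelli1//.
  exact: (measurableT_comp mf (measurable_cons_pair k)).
by move=> x /=.
Qed.

End tuple_probability.

(** * Replacing the arguments one at a time *)

Section extension.
Context {d : measure_display} {T : measurableType d} {R : realType}.

(** [F] and [H] stand for the positive and negative parts of [g] after the other arguments are
    integrated out. They take values in [0, +oo] because such integrals may be infinite, and they
    are compared rather than subtracted to avoid oo - oo. *)
Definition extends_le (B C : probability T R -> Prop) :=
  forall F H : T -> \bar R,
    measurable_fun setT F -> measurable_fun setT H ->
    (forall x, 0 <= F x) -> (forall x, 0 <= H x) ->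
    (forall tau, B tau -> \int[tau]_x H x <= \int[tau]_x F x) ->
    forall mu, C mu -> \int[mu]_x H x <= \int[mu]_x F x.

(** Induction on [k]: the head is replaced by means of [BC ord0], the tail by means of the induction
    hypothesis, and Tonelli exchanges the two. *)
Lemma tuple_prob_extends_le k (B C : 'I_k -> probability T R -> Prop)
    (F H : k.-tuple T -> \bar R) :
  (forall i, extends_le (B i) (C i)) ->
  measurable_fun setT F -> measurable_fun setT H ->
  (forall t, 0 <= F t) -> (forall t, 0 <= H t) ->
  (forall tau : 'I_k -> probability T R, (forall i, B i (tau i)) ->
    \int[tuple_prob k tau]_t H t <= \int[tuple_prob k tau]_t F t) ->
  forall mu : 'I_k -> probability T R, (forall i, C i (mu i)) ->
    \int[tuple_prob k mu]_t H t <= \int[tuple_prob k mu]_t F t.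
Proof.
elim: k B C F H => [|k IH] B C F H BC mF mH F0 H0 HF mu Cmu.
  by apply: HF => -[].
have mcons (f : k.+1.-tuple T -> \bar R) :
    measurable_fun [set: k.+1.-tuple T] f ->
    measurable_fun setT (fun x : T * k.-tuple T => f [tuple of x.1 :: x.2]).
  by move=> mf; exact: (measurableT_comp mf (measurable_cons_pair k)).
rewrite !ge0_integral_tuple_probS//.
(* As functions of the head, take the integrals over the tail under its final laws. *)
apply: (BC ord0) => //.
- exact: (measurable_fun_fubini_tonelli_F _ (mcons _ mF)).
- exact: (measurable_fun_fubini_tonelli_F _ (mcons _ mH)).
- by move=> x; exact: integral_ge0.
- by move=> x; exact: integral_ge0.
move=> tau Btau.
(* With the head law [tau] fixed, the tail becomes the outer variable, and the integrals over the
   head are the functions given to the induction hypothesis. *)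
rewrite (fubini_tonelli _ (mcons _ mF))// (fubini_tonelli _ (mcons _ mH))//.
apply: (IH (B \o lift ord0) (C \o lift ord0)) => //.
- by move=> i; exact: BC.
- exact: (measurable_fun_fubini_tonelli_G _ (mcons _ mF)).
- exact: (measurable_fun_fubini_tonelli_G _ (mcons _ mH)).
- by move=> x; exact: integral_ge0.
- by move=> x; exact: integral_ge0.
- move=> tau' Btau'.
  rewrite -(fubini_tonelli _ (mcons _ mF))// -(fubini_tonelli _ (mcons _ mH))//.
  (* The family with [tau] at the head and [tau'] on the tail. *)
  pose ntau i := oapp tau' tau (unlift ord0 i).
  have ntau0 : ntau ord0 = tau by rewrite /ntau unlift_none.
  have ntauS : ntau \o lift ord0 = tau'.
    by apply/funext => i /=; rewrite /ntau liftK.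
  have := HF ntau; rewrite !ge0_integral_tuple_probS// ntau0 ntauS; apply.
  by move=> i; rewrite /ntau; case: unliftP => [j ->|->]; [exact: Btau'|].
- by move=> i; exact: Cmu.
Qed.

End extension.

(** * One variable: laws on at most two points, and symmetric laws *)

Section one_variable.
Context {R : realType}.
Implicit Types (tau mu : probability R R) (F H : R -> \bar R).

Definition law_at (x : R) tau :=
  forall A : set R, measurable A -> tau A = \d_x A.

Definition law_on_pair (p q x y : R) tau := forall A : set R, measurable A ->
  tau A = p%:E * \d_x A + q%:E * \d_y A.

Definition choose_between (x y : R) (b : bool) : R := if b then x else y.

Lemma measurable_choose_between x y : measurable_fun setT (choose_between x y).
Proof. by []. Qed.

HB.instance Definition _ (x y : R) :=
  isMeasurableFun.Build _ _ _ _ (choose_between x y)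
    (measurable_choose_between x y).

(** As the image of a Bernoulli law, this is a probability by construction, and integrals against it
    reduce to two-term sums. *)
Definition pair_law (p x y : R) : probability R R :=
  distribution (bernoulli_prob p) (choose_between x y).

Lemma pair_lawP (p x y : R) : (0 <= p <= 1)%R ->
  law_on_pair p (1 - p)%R x y (pair_law p x y).
Proof.
move=> p01 A mA; rewrite /pair_law /distribution/= /pushforward.
by rewrite bernoulli_probE// /dirac !indicE.
Qed.

Lemma ge0_integral_pair_law (p x y : R) F : (0 <= p <= 1)%R ->
  measurable_fun setT F -> (forall z, 0 <= F z) ->
  \int[pair_law p x y]_z F z = p%:E * F x + (1 - p)%:E * F y.
Proof.
move=> p01 mF F0; rewrite ge0_integral_distribution// integral_bernoulli_prob//.
by move=> b /=.
Qed.

Definition centered_pair_law tau := exists a b : R,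
  [/\ (0 < a)%R, (0 < b)%R &
    law_on_pair (b / (a + b)) (a / (a + b)) (- a) b tau].

Definition symmetric_pair_law tau := exists a : R,
  (0 < a)%R /\ law_on_pair 2^-1 2^-1 (- a) a tau.

Definition centered_law mu :=
  mu.-integrable setT EFin /\ \int[mu]_x x%:E = 0.

Definition symmetric_law mu :=
  forall A : set R, measurable A -> mu A = mu (-%R @^-1` A).

Lemma law_at_dirac (x : R) : law_at x (\d_x : probability R R).
Proof. by []. Qed.

(** Twice the integral of [F] is that of [F x + F (- x)], and these sums compare pointwise: for
    [x != 0] by the symmetric law on the points [x] and [- x], for [x = 0] by the point mass at
    0. *)
Lemma symmetric_extends_le :
  extends_le (fun tau => symmetric_pair_law tau \/ law_at 0%R tau)
    symmetric_law.
Proof.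
move=> F H mF mH F0 H0 HF mu smu.
have mN (f : R -> \bar R) : measurable_fun setT f ->
    measurable_fun setT (f \o -%R : R -> \bar R).
  by move=> mf; exact: (measurableT_comp mf (@oppr_measurable R setT)).
have intN (f : R -> \bar R) : measurable_fun setT f -> (forall x, 0 <= f x) ->
    2%:R%:E * \int[mu]_x f x = \int[mu]_x (f x + f (- x)%R).
  move=> mf f0; rewrite ge0_integralD//; last exact: mN.
  rewrite mule_natl mule2n; congr (_ + _).
  (* By symmetry [mu] may be exchanged for its image under negation. *)
  rewrite [LHS](@eq_measure_integral _ _ _ _ (pushforward mu -%R)); last first.
    by move=> A mA _; exact: smu.
  by rewrite ge0_integral_pushforward//; exact: oppr_measurable.
have HF2 a : (0 < a)%R -> H (- a)%R + H a <= F (- a)%R + F a.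
  move=> a0.
  have h01 : (0 <= (2^-1 : R) <= 1)%R.
    by rewrite invr_ge0 invf_le1//= ler0n ler1n.
  have hh : (1 - 2^-1 = 2^-1 :> R)%R.
    by rewrite [X in (X - _)%R](splitr 1) div1r addrK.
  have /HF : symmetric_pair_law (pair_law 2^-1 (- a) a) \/
      law_at 0%R (pair_law 2^-1 (- a) a).
    left; exists a; split=> //.
    by have := pair_lawP _ (- a)%R a h01; rewrite hh.
  by rewrite !ge0_integral_pair_law// hh -!ge0_muleDr// lee_pmul2l//
    lte_fin invr_gt0.
rewrite -(@lee_pmul2l _ 2%:R%:E)//.
rewrite !intN//; apply: ge0_le_integral => //.
- by move=> x _; exact: adde_ge0.
- by apply: emeasurable_funD => //; exact: mN.
- by apply: emeasurable_funD => //; exact: mN.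
move=> x _.
have [x0|x0|->] := ltgtP x 0%R.
- by have := HF2 (- x)%R; rewrite opprK oppr_gt0; exact.
- by rewrite addeC [leRHS]addeC; exact: HF2.
- have /HF : symmetric_pair_law \d_(0%R : R) \/
      law_at 0%R (\d_(0%R : R) : probability R R).
    by right; exact: law_at_dirac.
  by rewrite !integral_dirac//= !diracT !mul1e oppr0 => ?; exact: leeD.
Qed.

(** * One variable: centered laws *)

Local Notation pos := [set x : R | (0 < x)%R].
Local Notation neg := [set x : R | (x < 0)%R].

(** The two integrals are those of the positive and negative parts of the identity; integrability
    makes them finite, and mean zero makes them equal. *)
Lemma integral_centered_law mu : centered_law mu ->
  exists2 c : R, (0 <= c)%R &
    \int[mu]_(x in pos) x%:E = c%:E /\
    \int[mu]_(x in neg) (- x)%:E = c%:E.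
Proof.
move=> [imu mu0].
have fp := integrable_pos_fin_num measurableT imu.
have fn := integrable_neg_fin_num measurableT imu.
have -> : \int[mu]_(x in pos) x%:E = \int[mu]_x EFin^\+ x.
  rewrite integral_mkcond; apply: eq_integral => x _.
  rewrite patchE funeposE; case: ifPn => [/[!inE]|].
    by move=> /= x0; rewrite max_l// lee_fin ltW.
  by rewrite notin_setE/= => /negP; rewrite -leNgt => x0; rewrite max_r.
have -> : \int[mu]_(x in neg) (- x)%:E = \int[mu]_x EFin^\- x.
  rewrite integral_mkcond; apply: eq_integral => x _.
  rewrite patchE funenegE; case: ifPn => [/[!inE]|].
    by move=> /= x0; rewrite max_l// lee_fin oppr_ge0 ltW.
  rewrite notin_setE/= => /negP; rewrite -leNgt => x0.
  by rewrite max_r// lee_fin oppr_le0.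
exists (fine (\int[mu]_x EFin^\+ x)).
  by apply: fine_ge0; exact: integral_ge0.
rewrite fineK//; split=> //.
move: mu0; rewrite integralE => /eqP; rewrite sube_eq ?fin_num_adde_defl//.
by rewrite add0e => /eqP.
Qed.

Let mpos : measurable pos.
Proof. by rewrite -set_itvoy; exact: measurable_itv. Qed.

Let mneg : measurable neg.
Proof. by rewrite -set_itvNyo; exact: measurable_itv. Qed.

(** The origin is kept apart because centered two-point laws do not charge it; the point mass at 0
    accounts for it. *)
Lemma ge0_integral_by_sign mu F :
  measurable_fun setT F -> (forall x, 0 <= F x) ->
  \int[mu]_x F x = F 0%R * mu [set 0%R] +
    (\int[mu]_(x in neg) F x + \int[mu]_(x in pos) F x).
Proof.
move=> mF F0.
have -> : [set: R] = [set 0%R] `|` (neg `|` pos).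
  apply/seteqP; split => // x _ /=.
  by have [x0|x0|->] := ltgtP x 0%R; [right; left|right; right|left].
rewrite ge0_integral_setU//; first last.
- apply/disj_setPLR => x /= -> []; rewrite ltxx//.
- exact: measurable_funTS.
- exact: measurableU.
congr (_ + _).
  rewrite (eq_integral (cst (F 0%R))); last by move=> x /[!inE] ->.
  by rewrite integral_cst.
rewrite ge0_integral_setU//; first exact: measurable_funTS.
by apply/disj_setPLR => x /= x0; apply/negP; rewrite -leNgt ltW.
Qed.

Let mid D : measurable_fun D (EFin : R -> \bar R).
Proof. exact/measurable_EFinP. Qed.

Let mopp D : measurable_fun D (fun x : R => (- x)%:E).
Proof. by apply/measurable_EFinP; exact: oppr_measurable. Qed.

(** Inner integral, over [y > 0] with [x < 0] fixed, of the unnormalized two-point mean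
    [y * F x - x * F y]. *)
Lemma ge0_integral_mix_pos mu F (c x : R) :
  measurable_fun setT F -> (forall y, 0 <= F y) -> (x < 0)%R ->
  \int[mu]_(y in pos) y%:E = c%:E ->
  \int[mu]_(y in pos) (y%:E * F x + (- x)%:E * F y) =
  c%:E * F x + (- x)%:E * \int[mu]_(y in pos) F y.
Proof.
move=> mF F0 x0 cE.
have nx0 : 0 <= (- x)%:E by rewrite lee_fin oppr_ge0 ltW.
have mFD D : measurable_fun D F by exact: measurable_funTS.
rewrite ge0_integralD//; first last.
- exact: measurable_funeM.
- by move=> y _; exact: mule_ge0.
- by apply: emeasurable_funM => //; exact: measurable_cst.
- by move=> y /= /ltW y0; apply: mule_ge0.
rewrite ge0_integralZr//; last by move=> y /= /ltW.
by rewrite cE ge0_integralZl.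
Qed.

(** Outer integral, over [x < 0]. With [K] the integral of [F] over [y > 0], the result is [c] times
    the integral of [F] over the nonzero reals. *)
Lemma ge0_integral_mix_neg mu F (c : R) (K : \bar R) :
  measurable_fun setT F -> (forall y, 0 <= F y) -> (0 <= c)%R -> 0 <= K ->
  \int[mu]_(x in neg) (- x)%:E = c%:E ->
  \int[mu]_(x in neg) (c%:E * F x + (- x)%:E * K) =
  c%:E * (\int[mu]_(x in neg) F x + K).
Proof.
move=> mF F0 c0 K0 cE.
have mFD D : measurable_fun D F by exact: measurable_funTS.
rewrite ge0_integralD//; first last.
- by apply: emeasurable_funM => //; exact: measurable_cst.
- by move=> x /= x0; apply: mule_ge0 => //; rewrite lee_fin oppr_ge0 ltW.
- exact: measurable_funeM.
- by move=> x _; exact: mule_ge0.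
rewrite ge0_integralZl// ge0_integralZr//; last first.
  by move=> x /= x0; rewrite lee_fin oppr_ge0 ltW.
by rewrite cE [RHS]ge0_muleDr//; exact: integral_ge0.
Qed.

(** A nonnegative function with zero integral vanishes almost everywhere, whereas [h] vanishes
    nowhere on [D]. *)
Lemma integral0_measure0 mu (D : set R) (h : R -> R) :
  measurable D -> measurable_fun D h -> (forall x, D x -> 0 < h x)%R ->
  \int[mu]_(x in D) (h x)%:E = 0 -> mu D = 0.
Proof.
move=> mD mh h0 ih0.
have : ae_eq mu D (EFin \o h) (cst 0).
  apply/ae_eq_integral_abs => //; first exact/measurable_EFinP.
  rewrite -[RHS]ih0; apply: eq_integral => x /[!inE] Dx /=.
  by rewrite gtr0_norm// h0.
move=> [N [mN N0 sub]].
apply: (subset_measure0 mD mN _ N0) => x Dx; apply: sub => /= /(_ Dx) [hx0].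
by have := h0 _ Dx; rewrite hx0 ltxx.
Qed.

(** The two-point inequalities, scaled by [y - x], are integrated over [x < 0 < y] against [mu]
    twice; cancelling [c] leaves the inequality off the origin. *)
Lemma centered_extends_le :
  extends_le (fun tau => centered_pair_law tau \/ law_at 0%R tau) centered_law.
Proof.
move=> F H mF mH F0 H0 HF mu cmu.
have [c c0 [cp cn]] := integral_centered_law mu cmu.
have HF0 : H 0%R <= F 0%R.
  have /HF : centered_pair_law \d_(0%R : R) \/
      law_at 0%R (\d_(0%R : R) : probability R R).
    by right; exact: law_at_dirac.
  by rewrite !integral_dirac//= !diracT !mul1e.
have HF2 x y : (x < 0)%R -> (0 < y)%R ->
    y%:E * H x + (- x)%:E * H y <= y%:E * F x + (- x)%:E * F y.
  (* The centered law on [x] and [y] has weights [y / s] and [- x / s]; multiplication by [s] clears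
     the denominators. *)
  rewrite -oppr_gt0 => x0 y0; pose s := (- x + y)%R.
  have s0 : (0 < s)%R by exact: addr_gt0.
  have p01 : (0 <= y / s <= 1)%R.
    by rewrite ler_pdivrMr// mul1r lerDr (ltW x0) divr_ge0// ltW.
  have q : (1 - y / s = - x / s)%R.
    by rewrite -[X in (X - _)%R](@divff _ s) ?gt_eqF// -mulrBl addrK.
  have /HF : centered_pair_law (pair_law (y / s) x y) \/
      law_at 0%R (pair_law (y / s) x y).
    left; exists (- x)%R, y; split=> //.
    by have := pair_lawP _ x y p01; rewrite q opprK.
  rewrite !ge0_integral_pair_law// q => HFxy.
  have sE (f : R -> \bar R) : (forall x, 0 <= f x) ->
      y%:E * f x + (- x)%:E * f y =
      s%:E * ((y / s)%:E * f x + (- x / s)%:E * f y).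
    move=> f0; rewrite ge0_muleDr; first last.
    - by rewrite mule_ge0// lee_fin divr_ge0 ?ltW.
    - by rewrite mule_ge0// lee_fin divr_ge0 ?ltW.
    by rewrite !muleA -!EFinM !(mulrC s) !divfK// gt_eqF.
  by rewrite !sE// lee_pmul2l// lte_fin.
rewrite !ge0_integral_by_sign//; apply: leeD; first by rewrite lee_wpmul2r.
have mHD D : measurable_fun D H by exact: measurable_funTS.
have mFD D : measurable_fun D F by exact: measurable_funTS.
have IH0 : 0 <= \int[mu]_(y in pos) H y by exact: integral_ge0.
have IF0 : 0 <= \int[mu]_(y in pos) F y by exact: integral_ge0.
(* If [c = 0], it cannot be cancelled, but then [mu] is concentrated at 0 and both sides vanish. *)
have [c_eq0|c_neq0] := eqVneq c 0%R.
  have mu_pos : mu pos = 0.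
    by apply: (@integral0_measure0 _ _ id) => //; rewrite cp c_eq0.
  have mu_neg : mu neg = 0.
    apply: (@integral0_measure0 _ _ -%R) => //; last by rewrite cn c_eq0.
    by move=> x /=; rewrite oppr_gt0.
  by rewrite !null_set_integral.
have c_gt0 : (0 < c)%R by rewrite lt_def c_neq0.
(* Multiplied by [c], both sides become iterated integrals, to be compared pointwise first in [x],
   then in [y]. *)
rewrite -(@lee_pmul2l _ c%:E)// -!ge0_integral_mix_neg//.
have mmix (f : R -> \bar R) (K : \bar R) : measurable_fun setT f ->
    measurable_fun neg (fun x : R => c%:E * f x + (- x)%:E * K).
  move=> /measurable_funTS mf; apply: emeasurable_funD;
    first exact: measurable_funeM.
  by apply: emeasurable_funM => //; exact: measurable_cst.
apply: ge0_le_integral; [exact: mneg| |exact: mmix|exact: mmix|].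
  move=> x /= x0; apply: adde_ge0; apply: mule_ge0 => //.
  by rewrite lee_fin oppr_ge0 ltW.
move=> x /= x0.
rewrite -!ge0_integral_mix_pos//.
have mmix' (f : R -> \bar R) (K : \bar R) : measurable_fun setT f ->
    measurable_fun pos (fun y : R => y%:E * K + (- x)%:E * f y).
  move=> /measurable_funTS mf; apply: emeasurable_funD;
    last exact: measurable_funeM.
  by apply: emeasurable_funM => //; exact: measurable_cst.
apply: ge0_le_integral; [exact: mpos| |exact: mmix'|exact: mmix'|].
  move=> y /= y0; apply: adde_ge0; apply: mule_ge0 => //;
    rewrite lee_fin ?ltW//.
  by rewrite oppr_gt0.
by move=> y /= y0; exact: HF2.
Qed.

End one_variable.

(** * The joint law of independent variables *)

Section independence.
Context {d : measure_display} {T : measurableType d} {R : realType}.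
Variables (P : probability T R) (k : nat) (X : 'I_k -> {RV P >-> R}).

Definition joint (w : T) : k.-tuple R := [tuple X i w | i < k].

Lemma measurable_joint : measurable_fun setT joint.
Proof.
apply/measurable_fun_tnthP => i.
rewrite (_ : _ \o _ = X i); first exact: measurable_funP.
by apply/funext => w /=; rewrite tnth_mktuple.
Qed.

HB.instance Definition _ :=
  isMeasurableFun.Build _ _ _ _ joint measurable_joint.

(** Independence is the product formula on boxes, and boxes determine the law. *)
Lemma joint_law (mu : 'I_k -> probability R R) :
  mutually_independent X ->
  (forall i (A : set R), measurable A -> P (X i @^-1` A) = mu i A) ->
  forall B, measurable B -> distribution P joint B = tuple_prob k mu B.
Proof.
move=> indX Xmu; apply: (tuple_prob_unique k mu (distribution P joint)) => A mA.
transitivity (P (\bigcap_(i in [set: 'I_k]) X i @^-1` A i)).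
  congr (P _); apply/seteqP.
  by split => w wA i _; have := wA i I; rewrite /= tnth_mktuple.
by rewrite indX//; apply: eq_bigr => i _; exact: Xmu.
Qed.

Lemma ge0_integral_joint (mu : 'I_k -> probability R R)
    (F : k.-tuple R -> \bar R) :
  mutually_independent X ->
  (forall i (A : set R), measurable A -> P (X i @^-1` A) = mu i A) ->
  measurable_fun setT F -> (forall t, 0 <= F t) ->
  \int[P]_w F (joint w) = \int[tuple_prob k mu]_t F t.
Proof.
move=> indX Xmu mF F0.
transitivity (\int[distribution P joint]_t F t).
  by rewrite ge0_integral_distribution.
by apply: eq_measure_integral => A mA _; exact: joint_law.
Qed.

End independence.

(** * Independent variables with prescribed laws on the product space *)

Section coordinates.
Context {R : realType} (k : nat) (mu : 'I_k -> probability R R).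
Variable phi : 'I_k -> R -> R.
Hypothesis mphi : forall i, measurable_fun setT (phi i).

(** The maps [phi i] allow a coordinate that is only almost surely 0 to be replaced by the constant
    0. *)
Definition coordinate (i : 'I_k) (t : k.-tuple R) : R := phi i (tnth t i).

Lemma measurable_coordinate i : measurable_fun setT (coordinate i).
Proof. exact: (measurableT_comp (mphi i) (measurable_tnth i)). Qed.

HB.instance Definition _ i := isMeasurableFun.Build _ _ _ _ (coordinate i)
  (measurable_coordinate i).

Definition coordinate_rv (i : 'I_k) : {RV (tuple_prob k mu) >-> R} :=
  coordinate i.

Lemma coordinate_law i (A : set R) : measurable A ->
  tuple_prob k mu (coordinate_rv i @^-1` A) = mu i (phi i @^-1` A).
Proof.
move=> mA.
have mpA : measurable (phi i @^-1` A) by rewrite -[_ @^-1` _]setTI; exact: mphi.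
pose B j := if j == i then phi i @^-1` A else setT.
rewrite (_ : _ @^-1` A = box k B); last first.
  apply/seteqP; split => t /=.
    by move=> tA j _; rewrite /B/=; case: eqP => // ->.
  by move=> /(_ i I); rewrite /B/= eqxx.
rewrite tuple_prob_box; last by move=> j; rewrite /B; case: ifP.
rewrite (bigD1 i)//= /B eqxx big1 ?mule1// => j /negbTE ->.
exact: probability_setT.
Qed.

Lemma coordinates_independent : mutually_independent coordinate_rv.
Proof.
move=> A mA.
under eq_bigr do rewrite coordinate_law//.
rewrite -(tuple_prob_box k mu (fun i => phi i @^-1` A i)) => [|i]//.
by rewrite -[_ @^-1` _]setTI; exact: mphi.
Qed.

End coordinates.

(** * The sign of an expectation through positive and negative parts *)

Section expectation_sign.
Context {d : measure_display} {T : measurableType d} {R : realType}.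
Variables (P : probability T R) (Y : T -> R).

Lemma expectationE_posneg : 'E_P[Y] =
  \int[P]_w (Num.max (Y w) 0)%:E - \int[P]_w (Num.max (- Y w) 0)%:E.
Proof.
rewrite unlock integralE; congr (_ - _); apply: eq_integral => w _.
  by rewrite funeposE EFin_max.
by rewrite funenegE EFin_max.
Qed.

(** If the positive part has infinite integral, the bound is trivial. Otherwise a nonnegative
    difference forces the negative part to have finite integral too, and real subtraction
    applies. *)
Lemma expectation_ge0_posneg_le : 0 <= 'E_P[Y] ->
  \int[P]_w (Num.max (- Y w) 0)%:E <= \int[P]_w (Num.max (Y w) 0)%:E.
Proof.
rewrite expectationE_posneg.
case: (\int[P]_w (Num.max (Y w) 0)%:E) => [r| |];
  case: (\int[P]_w (Num.max (- Y w) 0)%:E) => [s| |] //=;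
  rewrite ?leNye ?leey//.
by rewrite -EFinB !lee_fin subr_ge0.
Qed.

(** Existence makes one of the two integrals finite, so their difference is not oo - oo. *)
Lemma posneg_le_expectation_ge0 : expectation_exists P Y ->
  \int[P]_w (Num.max (- Y w) 0)%:E <= \int[P]_w (Num.max (Y w) 0)%:E ->
  0 <= 'E_P[Y].
Proof.
move=> PY; rewrite expectationE_posneg sube_ge0//.
have n0 : 0 <= \int[P]_w (Num.max (- Y w) 0)%:E.
  by apply: integral_ge0 => w _; rewrite lee_fin le_max lexx orbT.
have p0 : 0 <= \int[P]_w (Num.max (Y w) 0)%:E.
  by apply: integral_ge0 => w _; rewrite lee_fin le_max lexx orbT.
rewrite !ge0_fin_numE// orbC; apply/orP.
by move: PY; rewrite /expectation_exists unlock.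
Qed.

End expectation_sign.

(** * Passage from random variables to laws, and the theorem *)

Lemma centered_distribution {d} {T : measurableType d} {R : realType}
  (P : probability T R) (X : {RV P >-> R}) :
  centered X -> centered_law (distribution P X).
Proof.
rewrite /centered expectation_def => -[iX X0].
have mE : measurable_fun setT (EFin : R -> \bar R) by exact/measurable_EFinP.
split; last exact: etrans (integral_distribution mE iX) X0.
exact: (integrable_pushforward (measurable_funP X) mE iX measurableT).
Qed.

Theorem theoremE (R : realType) (m n : nat) (g : (m + n).-tuple R -> R)
  (g_borel : measurable_fun [set: (m + n).-tuple R] g)
  (g_two_point : forall (d : measure_display) (T : measurableType d)
      (P : probability T R) (X : 'I_(m + n) -> {RV P >-> R}),
    mutually_independent X ->
    (forall j : 'I_m,
      centered_two_point (X (lshift n j)) \/ zero_rv (X (lshift n j))) ->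
    (forall j : 'I_n,
      symmetric_two_point (X (rshift m j)) \/ zero_rv (X (rshift m j))) ->
    0 <= 'E_P[apply_rvs g X])
  (d : measure_display) (T : measurableType d) (P : probability T R)
  (X : 'I_(m + n) -> {RV P >-> R}) :
  mutually_independent X ->
  (forall j : 'I_m, centered (X (lshift n j))) ->
  (forall j : 'I_n, symmetric_rv (X (rshift m j))) ->
  expectation_exists P (apply_rvs g X) ->
  0 <= 'E_P[apply_rvs g X].
Proof.
move=> indX cX sX exX.
pose pairs (i : 'I_(m + n)) := if fintype.split i is inl _
  then @centered_pair_law R else @symmetric_pair_law R.
pose laws (i : 'I_(m + n)) := if fintype.split i is inl _
  then @centered_law R else @symmetric_law R.
have ext i : extends_le (fun tau => pairs i tau \/ law_at 0%R tau) (laws i).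
  rewrite /pairs /laws; case: (fintype.split i) => _.
    exact: centered_extends_le.
  exact: symmetric_extends_le.
have lawX i : laws i (distribution P (X i)).
  rewrite /laws; case: (splitP i) => j ij.
    rewrite (_ : i = lshift n j); last exact: val_inj.
    exact: centered_distribution.
  rewrite (_ : i = rshift m j); last exact: val_inj.
  by move=> A mA; exact: sX.
pose gp (t : (m + n).-tuple R) := (Num.max (g t) 0)%:E.
pose gn (t : (m + n).-tuple R) := (Num.max (- g t) 0)%:E.
have mgp : measurable_fun setT gp.
  apply/measurable_EFinP; apply: measurable_maxr => //; exact: measurable_cst.
have mgn : measurable_fun setT gn.
  apply/measurable_EFinP; apply: measurable_maxr; last exact: measurable_cst.
  exact: (measurableT_comp (@oppr_measurable R setT) g_borel).
have gp0 t : 0 <= gp t by rewrite lee_fin le_max lexx orbT.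
have gn0 t : 0 <= gn t by rewrite lee_fin le_max lexx orbT.
apply: posneg_le_expectation_ge0 => //.
rewrite [leLHS](ge0_integral_joint P _ X (fun i => distribution P (X i)) gn)//.
rewrite [leRHS](ge0_integral_joint P _ X (fun i => distribution P (X i)) gp)//.
(* The inequality now concerns only laws, so it suffices to treat two-point laws and point masses at
   0. *)
apply: (tuple_prob_extends_le _ _ _ _ _ ext) => // tau Btau.
(* [zero_rv] asks for [Y i] to vanish everywhere, not just almost surely. *)
pose phi i : R -> R := if `[< law_at 0%R (tau i) >] then cst 0%R else id.
have mphi i : measurable_fun setT (phi i).
  rewrite /phi; case: asboolP => _;
    [exact: measurable_cst|exact: measurable_id].
pose Y := coordinate_rv _ tau phi mphi.
have indY : mutually_independent Y by exact: coordinates_independent.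
(* Where [phi i] is the constant 0, the law [tau i] is already the point mass at 0, so it is
   preserved. *)
have lawY i A : measurable A -> tuple_prob _ tau (Y i @^-1` A) = tau i A.
  move=> mA; rewrite coordinate_law// /phi; case: asboolP => // tau0.
  rewrite [RHS]tau0// diracE preimage_cst; case: ifPn => _.
    exact: probability_setT.
  exact: measure0.
have zeroY i : law_at 0%R (tau i) -> zero_rv (Y i).
  by move=> tau0 w; rewrite /Y/= /coordinate /phi asboolT.
rewrite -(ge0_integral_joint (tuple_prob _ tau) _ Y tau gn)//.
rewrite -(ge0_integral_joint (tuple_prob _ tau) _ Y tau gp)//.
apply: expectation_ge0_posneg_le.
apply: (g_two_point _ _ _ Y) => // j.
- have := Btau (lshift n j).
  (* Writing the index as an [unsplit] lets the case distinction in [pairs] compute. *)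
  rewrite /pairs -[lshift n j]/(unsplit (inl j)) unsplitK.
  move=> [[a [b [a0 b0 ab]]]|tau0]; last by right; exact: zeroY.
  by left; exists a, b; split=> // A mA; rewrite -ab//; exact: lawY.
- have := Btau (rshift m j).
  rewrite /pairs -[rshift m j]/(unsplit (inr j)) unsplitK.
  move=> [[a [a0 ab]]|tau0]; last by right; exact: zeroY.
  by left; exists a; split=> // A mA; rewrite -ab//; exact: lawY.
Qed.
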